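(* Assume that the Hamiltonian $(H_0,H_1)$ of the system $$\dot\rho(t)=-i[H_0+f(\rho,\rho_d)H_1,\rho(t)],\quad \dot\rho_d(t)=-i[H_0,\rho_d(t)],\quad f(\rho,\rho_d)=\mathrm{Tr}([-iH_1,\rho]\rho_d)$$ on $\mathcal{M}\times\mathcal{M}$ is ideal. Then a pair $(\rho_1,\rho_2)\in\mathcal{M}\times\mathcal{M}$ belongs to the invariant set $E$ if and only if the commutator $[\rho_1,\rho_2]$ is a diagonal matrix, $[\rho_1,\rho_2]=\mathrm{diag}(c_1,\ldots,c_n)$.
   Context: A density operator is a positive semidefinite Hermitian $n\times n$ matrix of trace $1$; $\mathcal{M}$ is the manifold of all density operators with the same spectrum as a given density operator $\rho_d(0)$. $H_0,H_1$ are Hermitian, and one works in a basis in which $H_0=\mathrm{diag}(a_1,\ldots,a_n)$, $a_1\ge\cdots\ge a_n$. $[A,B]=AB-BA$. $V(\rho,\rho_d)=\frac12\mathrm{Tr}[(\rho-\rho_d)^2]$, and $E$ is the set of $(\rho_1,\rho_2)\in\mathcal{M}\times\mathcal{M}$ such that $\dot V(\rho(t),\rho_d(t))=0$ for all $t$ along the solution with $(\rho(0),\rho_d(0))=(\rho_1,\rho_2)$. With $\omega_{k\ell}=a_\ell-a_k$ and $b_{k\ell}$ the $(k,\ell)$ entry of $H_1$, the Hamiltonian is called ideal if (i) $H_0$ is strongly regular: for $k\ne\ell$, $p\ne q$, $\omega_{k\ell}\ne\omega_{pq}$ unless $(k,\ell)=(p,q)$; and (ii) $H_1$ is fully connected: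 $b_{k\ell}\ne0$ except (possibly) for $k=\ell$.
   Formalization: The formal theorem additionally assumes that all diagonal entries b_kk of H_1 are equal (e.g. zero); with unequal diagonal entries a diagonal commutator need not give f = 0, and the stated equivalence fails (already for n = 2). *)

(* Defs.v *)
From HB Require Import structures.
From mathcomp Require Import all_boot all_order all_algebra.
From mathcomp Require Import sesquilinear spectral complex.
From mathcomp Require Import all_classical all_reals all_analysis.
Set Implicit Arguments.
Unset Strict Implicit.
Unset Printing Implicit Defensive.
Import Order.TTheory GRing.Theory Num.Theory.
Import numFieldNormedType.Exports.

Local Open Scope ring_scope.
Local Open Scope complex_scope.
Local Open Scope sesquilinear_scope.

Definition comm_of (R : realType) (n : nat) (A B : 'M[R[i]]_n) : 'M[R[i]]_n :=
  A *m B - B *m A.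

(* In the order of [R[i]], [0 <= z] means that [z] is real and nonnegative. *)
Definition psd (R : realType) (n : nat) (A : 'M[R[i]]_n) : Prop :=
  A \is hermsymmx /\ forall v : 'cV[R[i]]_n, 0 <= (v ^t* *m A *m v) 0 0.

Definition density (R : realType) (n : nat) (A : 'M[R[i]]_n) : Prop :=
  psd A /\ \tr A = 1.

(* The spectrum is counted with multiplicities. *)
Definition same_spectrum (R : realType) (n : nat) (A B : 'M[R[i]]_n) : Prop :=
  forall z : R[i], mup z (char_poly A) = mup z (char_poly B).

Definition isospectral (R : realType) (n : nat) (rho0 rho : 'M[R[i]]_n) : Prop :=
  density rho /\ same_spectrum rho rho0.

(* [R[i]] carries no normed module structure over [R], so derivatives with
   respect to real time are taken on real and imaginary parts. *)
Definition is_cderive (R : realType) (u : R -> R[i]) (t : R) (d : R[i]) : Prop :=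
  is_derive t 1 (fun s => complex.Re (u s)) (complex.Re d) /\
  is_derive t 1 (fun s => complex.Im (u s)) (complex.Im d).

Definition is_mxderive (R : realType) (n : nat)
    (X : R -> 'M[R[i]]_n) (t : R) (D : 'M[R[i]]_n) : Prop :=
  forall i j, is_cderive (fun s => X s i j) t (D i j).

(* The values of [feedback] and [lyapunov] are real on Hermitian arguments. *)
Definition feedback (R : realType) (n : nat) (H1 rho rhod : 'M[R[i]]_n) : R[i] :=
  \tr (comm_of (- 'i *: H1) rho *m rhod).

Definition lyapunov (R : realType) (n : nat) (rho rhod : 'M[R[i]]_n) : R[i] :=
  2^-1 * \tr ((rho - rhod) *m (rho - rhod)).

(* The state space is the compact product of two isospectral manifolds, so
   solutions are global and are taken on the whole real line. *)
Definition is_solution (R : realType) (n : nat) (H0 H1 rho0 rho1 rho2 : 'M[R[i]]_n)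
    (rho rhod : R -> 'M[R[i]]_n) : Prop :=
  [/\ rho 0 = rho1 /\ rhod 0 = rho2,
      forall t, isospectral rho0 (rho t) /\ isospectral rho0 (rhod t),
      forall t, is_mxderive rho t
        (- 'i *: comm_of (H0 + feedback H1 (rho t) (rhod t) *: H1) (rho t))
    & forall t, is_mxderive rhod t (- 'i *: comm_of H0 (rhod t))].

(* "Along the solution" is rendered as existence of a solution together with a
   condition on every solution, so that membership is never vacuous and does
   not depend on a choice of solution. *)
Definition invariant_set (R : realType) (n : nat) (H0 H1 rho0 rho1 rho2 : 'M[R[i]]_n)
    : Prop :=
  [/\ isospectral rho0 rho1, isospectral rho0 rho2,
      exists rho rhod, is_solution H0 H1 rho0 rho1 rho2 rho rhod
    & forall rho rhod, is_solution H0 H1 rho0 rho1 rho2 rho rhod ->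
        forall t, is_cderive (fun s => lyapunov (rho s) (rhod s)) t 0].

Definition strongly_regular (R : realType) (n : nat) (a : 'I_n -> R) : Prop :=
  let omega k l := a l - a k in
  forall k l p q : 'I_n, k != l -> p != q ->
    omega k l = omega p q -> (k, l) = (p, q).

(* No condition on the diagonal entries. *)
Definition fully_connected (R : realType) (n : nat) (H1 : 'M[R[i]]_n) : Prop :=
  forall k l : 'I_n, k != l -> H1 k l != 0.

Definition ideal (R : realType) (n : nat) (a : 'I_n -> R) (H1 : 'M[R[i]]_n) : Prop :=
  strongly_regular a /\ fully_connected H1.

(* Ideality leaves the diagonal of [H1] free, but the characterisation of the
   invariant set by diagonal commutators fails without this condition: if
   [rho1, rho2] = diag(c), the feedback stays equal to - i * sum_k H1_kk c_k.
   For H0 = diag(1, 0), H1 = [[1, 1], [1, 0]], rho1 = (1 + X / 2) / 2 and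
   rho2 = (1 + Y / 2) / 2, with X and Y the first two Pauli matrices, the
   commutator is diag(i / 8, - i / 8) and the feedback is 1 / 8.  Since adding
   a scalar matrix to [H1] changes nothing, the condition amounts to a zero
   diagonal. *)
Definition constant_diagonal (R : realType) (n : nat) (H1 : 'M[R[i]]_n) : Prop :=
  forall k l : 'I_n, H1 k k = H1 l l.

(* Main.v *)
Require Import Defs.
From HB Require Import structures.
From mathcomp Require Import all_boot all_order all_algebra.
From mathcomp Require Import sesquilinear spectral complex.
From mathcomp Require Import all_classical all_reals all_analysis.
From mathcomp Require Import ring.
Set Implicit Arguments.
Unset Strict Implicit.
Unset Printing Implicit Defensive.
Import Order.TTheory GRing.Theory Num.Theory.
Import numFieldNormedType.Exports.
Local Open Scope ring_scope.
Local Open Scope complex_scope.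
Local Open Scope sesquilinear_scope.

(** Along every solution, [d/dt V = - f^2], so [(rho1, rho2)] lies in [E] iff
    the feedback [f] vanishes along the solution, which is then the free
    evolution under [H0].  On free evolutions [f] is a linear combination of
    the exponentials [exp(i omega_kl t)] with coefficients [b_lk c_kl], where
    [c = [rho1, rho2]]; strong regularity makes the frequencies distinct and
    nonzero, hence every off-diagonal [c_kl] vanishes.  Conversely, if [c] is
    diagonal then [f] is zero on the free evolution, which therefore solves
    the closed-loop system; a Gronwall estimate shows that no other solution
    starts at [(rho1, rho2)]. *)

(** * Differentiation in real time *)

Section ComplexDerivative.
Variable R : realType.
Implicit Types (t : R) (u v : R -> R[i]).

Lemma ReD (x y : R[i]) : complex.Re (x + y) = complex.Re x + complex.Re y.
Proof. by case: x y => [a b] [c d]. Qed.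

Lemma ImD (x y : R[i]) : complex.Im (x + y) = complex.Im x + complex.Im y.
Proof. by case: x y => [a b] [c d]. Qed.

Lemma ReM (x y : R[i]) :
  complex.Re (x * y) = complex.Re x * complex.Re y - complex.Im x * complex.Im y.
Proof. by case: x y => [a b] [c d]. Qed.

Lemma ImM (x y : R[i]) :
  complex.Im (x * y) = complex.Re x * complex.Im y + complex.Im x * complex.Re y.
Proof. by case: x y => [a b] [c d]. Qed.

Lemma is_cderive_unique u t d d' :
  is_cderive u t d -> is_cderive u t d' -> d = d'.
Proof.
move=> [Hr Hi] [Hr' Hi']; rewrite (complexE d) (complexE d').
by rewrite -(@derive_val _ _ _ _ _ _ _ Hr) -(@derive_val _ _ _ _ _ _ _ Hi)
  (@derive_val _ _ _ _ _ _ _ Hr') (@derive_val _ _ _ _ _ _ _ Hi').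
Qed.

Lemma is_cderive_cst (c : R[i]) t : is_cderive (fun=> c) t 0.
Proof. by split; exact: is_derive_cst. Qed.

Lemma is_cderiveD u v t du dv : is_cderive u t du -> is_cderive v t dv ->
  is_cderive (fun s => u s + v s) t (du + dv).
Proof.
move=> [ur ui] [vr vi]; split; rewrite ?ReD ?ImD.
- rewrite (_ : (fun s => _) =
      (fun s => complex.Re (u s)) + (fun s => complex.Re (v s))).
    exact: is_deriveD.
  by apply/funext => s; rewrite ?ReD ?ImD.
- rewrite (_ : (fun s => _) =
      (fun s => complex.Im (u s)) + (fun s => complex.Im (v s))).
    exact: is_deriveD.
  by apply/funext => s; rewrite ?ReD ?ImD.
Qed.

Lemma is_cderiveM u v t du dv : is_cderive u t du -> is_cderive v t dv ->
  is_cderive (fun s => u s * v s) t (du * v t + u t * dv).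
Proof.
move=> [ur ui] [vr vi].
split.
- rewrite (_ : (fun s => _) =
      (fun s => complex.Re (u s)) * (fun s => complex.Re (v s))
      - (fun s => complex.Im (u s)) * (fun s => complex.Im (v s))).
    apply: (is_derive_eq (is_deriveB (is_deriveM ur vr) (is_deriveM ui vi))).
    by rewrite ReD !ReM /GRing.scale /=; ring.
  by apply/funext => s; rewrite ReM.
- rewrite (_ : (fun s => _) =
      (fun s => complex.Re (u s)) * (fun s => complex.Im (v s))
      + (fun s => complex.Im (u s)) * (fun s => complex.Re (v s))).
    apply: (is_derive_eq (is_deriveD (is_deriveM ur vi) (is_deriveM ui vr))).
    by rewrite ImD !ImM /GRing.scale /=; ring.
  by apply/funext => s; rewrite ImM.
Qed.

Lemma is_cderiveZ (c : R[i]) u t du : is_cderive u t du ->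
  is_cderive (fun s => c * u s) t (c * du).
Proof.
by move=> /(is_cderiveM (is_cderive_cst c t)); rewrite mul0r add0r.
Qed.

Lemma is_cderiveB u v t du dv : is_cderive u t du -> is_cderive v t dv ->
  is_cderive (fun s => u s - v s) t (du - dv).
Proof.
move=> Hu /(is_cderiveZ (-1)) Hv.
have := is_cderiveD Hu Hv; rewrite mulN1r.
by under eq_fun do rewrite mulN1r.
Qed.

Lemma is_cderive_sum (I : Type) (r : seq I) (u : I -> R -> R[i]) du t :
  (forall i, is_cderive (u i) t (du i)) ->
  is_cderive (fun s => \sum_(i <- r) u i s) t (\sum_(i <- r) du i).
Proof.
move=> H; elim: r => [|i r IH].
  by rewrite big_nil; under eq_fun do rewrite big_nil; exact: is_cderive_cst.
rewrite big_cons; under eq_fun do rewrite big_cons.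
exact: is_cderiveD.
Qed.

Lemma is_cderive0_cst u : (forall t, is_cderive u t 0) -> forall s t, u s = u t.
Proof.
move=> H s t; rewrite (complexE (u s)) (complexE (u t)).
have -> : complex.Re (u s) = complex.Re (u t).
  by apply: (@is_derive_0_is_cst _ (fun s => complex.Re (u s))) => x; case: (H x).
have -> // : complex.Im (u s) = complex.Im (u t).
by apply: (@is_derive_0_is_cst _ (fun s => complex.Im (u s))) => x; case: (H x).
Qed.

(** * Derivatives of matrix-valued curves *)

Section MatrixDerivative.
Variable n : nat.
Implicit Types (X Y : R -> 'M[R[i]]_n).

Lemma is_mxderiveB X Y t dX dY : is_mxderive X t dX -> is_mxderive Y t dY ->
  is_mxderive (fun s => X s - Y s) t (dX - dY).
Proof.
move=> HX HY i j; rewrite !mxE; under eq_fun do rewrite !mxE.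
exact: is_cderiveB.
Qed.

Lemma is_cderive_trmul X Y t dX dY : is_mxderive X t dX -> is_mxderive Y t dY ->
  is_cderive (fun s => \tr (X s *m Y s)) t (\tr (dX *m Y t) + \tr (X t *m dY)).
Proof.
move=> HX HY.
have trE (A B : 'M[R[i]]_n) : \tr (A *m B) =
    \sum_i \sum_j A i j * B j i.
  by apply: eq_bigr => i _; rewrite mxE.
rewrite !trE -big_split /=; under eq_fun do rewrite trE.
apply: is_cderive_sum => i; rewrite -big_split /=.
by apply: is_cderive_sum => j; exact: is_cderiveM.
Qed.

End MatrixDerivative.

(** * The exponentials exp(ix): derivatives, scalar linear equations, linear independence *)

Definition phase (x : R) : R[i] := cos x +i* sin x.

Lemma phase0 : phase 0 = 1.
Proof. by rewrite /phase cos0 sin0. Qed.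

Lemma phaseD x y : phase (x + y) = phase x * phase y.
Proof.
by apply/eqP; rewrite /phase eq_complex /= cosD sinD eqxx addrC eqxx.
Qed.

Lemma conj_phase x : (phase x)^*%R = phase (- x).
Proof. by rewrite /phase cosN sinN. Qed.

Lemma phase_mulN x : phase x * phase (- x) = 1.
Proof. by rewrite -phaseD subrr phase0. Qed.

Lemma norm_phase x : `|phase x| = 1.
Proof. by rewrite normc_def /= cos2Dsin2 sqrtr1. Qed.

Lemma is_derive_mulr (w t : R) : is_derive t 1 ( *%R w) w.
Proof.
apply: (@trigger_derive _ _ _ _ _ (is_deriveZ w (is_derive_id t 1))).
by rewrite /GRing.scale /= mulr1.
Qed.

Lemma is_cderive_phase (w : R) t :
  is_cderive (fun s => phase (w * s)) t ('i%C * w%:C * phase (w * t)).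
Proof.
have Hm := is_derive_mulr w t.
split.
- apply: (is_derive_eq (is_derive1_comp (is_derive_cos _) Hm)).
  by rewrite /= ; ring.
- apply: (is_derive_eq (is_derive1_comp (is_derive_sin _) Hm)).
  by rewrite /= ; ring.
Qed.

(** The integrating factor [phase (- w * t)] turns [u] into a constant. *)
Lemma phase_ode u (w : R) : (forall t, is_cderive u t ('i%C * w%:C * u t)) ->
  forall t, u t = phase (w * t) * u 0.
Proof.
move=> Hu t.
have H s : is_cderive (fun s => phase (- w * s) * u s) s 0.
  have := is_cderiveM (is_cderive_phase (- w) s) (Hu s).
  by congr is_cderive; rewrite rmorphN /=; ring.
have := is_cderive0_cst H t 0.
rewrite mulr0 phase0 mul1r => <-.
by rewrite mulrA mulNr phase_mulN mul1r.
Qed.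

(** Induction on the list: the derivative of the relation minus ['i * w j] times the relation loses
    its head term [j], and every other coefficient is multiplied by a nonzero ['i * (w i - w j)]. *)
Lemma phase_free (I : eqType) (r : seq I) (w : I -> R) (c : I -> R[i]) :
  uniq [seq w i | i <- r] ->
  (forall t, \sum_(i <- r) c i * phase (w i * t) = 0) ->
  {in r, forall i, c i = 0}.
Proof.
elim: r c => [//|j r IH] c /= /andP[wj Ur] H.
have dH t : \sum_(i <- j :: r) c i * ('i%C * (w i)%:C * phase (w i * t)) = 0.
  have D : is_cderive (fun t => \sum_(i <- j :: r) c i * phase (w i * t)) t
      (\sum_(i <- j :: r) c i * ('i%C * (w i)%:C * phase (w i * t))).
    by apply: is_cderive_sum => i; apply: is_cderiveZ; exact: is_cderive_phase.
  apply: (is_cderive_unique D); under eq_fun do rewrite H.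
  exact: is_cderive_cst.
have Hr i : i \in r -> c i = 0.
  move=> ir.
  have /(_ i ir) /eqP : {in r, forall i, c i * ('i%C * (w i - w j)%:C) = 0}.
    apply: (IH _ Ur) => t.
    have : \sum_(i <- j :: r) c i * ('i%C * (w i - w j)%:C) * phase (w i * t) = 0.
      apply: (@eq_trans _ _
          (\sum_(i <- j :: r) c i * ('i%C * (w i)%:C * phase (w i * t))
          - 'i%C * (w j)%:C * \sum_(i <- j :: r) c i * phase (w i * t))).
        by rewrite mulr_sumr -sumrB; apply: eq_bigr => k _; rewrite rmorphB /=; ring.
      by rewrite dH H mulr0 subr0.
    by rewrite big_cons subrr !mulr0 mul0r add0r.
  rewrite !mulf_eq0 => /orP[/eqP //|].
  rewrite complexiE (negPf (neq0Ci _)) /= fmorph_eq0 subr_eq0 => /eqP wij.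
  by move: wj; rewrite -wij map_f.
move=> i; rewrite inE => /orP[/eqP ->|]; last exact: Hr.
(* At time 0 the phase of the head is 1, and the rest of the sum vanishes by [Hr]. *)
have := H 0; rewrite big_cons mulr0 phase0 mulr1 big_seq big1 ?addr0 // => k kr.
by rewrite Hr // mul0r.
Qed.

(** * Monotonicity and a Gronwall estimate on the whole line *)

Lemma nonincreasing_is_derive (f df : R -> R) :
  (forall t, is_derive t 1 f (df t)) -> (forall t, df t <= 0) ->
  forall s t, s <= t -> f t <= f s.
Proof.
move=> Hf Hd s t st.
have cf : {within `[s, t], continuous f}%classic.
  by apply: derivable_within_continuous => x _; exact: ex_derive.
have [c _ E] := MVT_segment st (fun x _ => Hf x) cf.
by rewrite -subr_le0 E mulr_le0_ge0 ?subr_ge0 //.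
Qed.

(** The product of [D] and [expR (- K * t)] is nonincreasing, which settles positive times; negative
    times follow by time reversal, since the bound on [dD] is two-sided. *)
Lemma gronwall_zero (D dD : R -> R) (K : R) :
  (forall t, is_derive t 1 D (dD t)) -> (forall t, `|dD t| <= K * D t) ->
  (forall t, 0 <= D t) -> D 0 = 0 -> forall t, D t = 0.
Proof.
have fwd (E dE : R -> R) : (forall t, is_derive t 1 E (dE t)) ->
    (forall t, dE t <= K * E t) -> E 0 = 0 -> forall t, 0 <= t -> E t <= 0.
  move=> HE bE E0 t t0.
  have dexp (s : R) : is_derive s 1 (fun x => expR (- K * x)) (expR (- K * s) * - K).
    exact: is_derive1_comp (is_derive_expR _) (is_derive_mulr _ _).
  have dP (s : R) : is_derive s 1 (E * (fun x => expR (- K * x)))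
      ((dE s - K * E s) * expR (- K * s)).
    by apply: (is_derive_eq (is_deriveM (HE s) (dexp s)));
      rewrite /GRing.scale /=; ring.
  have : E t * expR (- K * t) <= E 0 * expR (- K * 0).
    apply: (nonincreasing_is_derive dP _ t0) => s.
    by rewrite mulr_le0_ge0 ?expR_ge0 // subr_le0.
  by rewrite E0 mul0r pmulr_lle0 ?expR_gt0.
move=> HD bD D_ge0 D0 t; apply/eqP; rewrite eq_le D_ge0 andbT.
have [t0|/ltW t0] := leP 0 t.
  by apply: fwd t0 => // s; exact: le_trans (ler_norm _) (bD s).
rewrite -[t]opprK; apply: (fwd (D \o -%R) (fun s => - dD (- s))).
- move=> s; have := is_derive1_comp (HD (- s)) (is_deriveNid s 1).
  by rewrite mulrN1.
- by move=> s; apply: le_trans (ler_norm _) _; rewrite normrN; exact: bD.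
- by rewrite /= oppr0.
- by rewrite oppr_ge0.
Qed.

End ComplexDerivative.

(** * Commutators, traces and norms *)

(** Scalar matrices are central, so X - UAV = U (X - A) V, and the determinants of [U] and [V]
    cancel. *)
Lemma char_poly_conj (F : comNzRingType) n (A U V : 'M[F]_n) :
  U *m V = 1%:M -> char_poly (U *m A *m V) = char_poly A.
Proof.
move=> UV; rewrite /char_poly.
have PQ : map_mx polyC U *m map_mx polyC V = 1%:M.
  by rewrite -map_mxM UV map_mx1.
rewrite (_ : char_poly_mx _ = map_mx polyC U *m char_poly_mx A *m map_mx polyC V).
  by rewrite !det_mulmx mulrAC -det_mulmx PQ det1 mul1r.
rewrite /char_poly_mx mulmxBr mulmxBl -!map_mxM; congr (_ - _).
by rewrite scalar_mxC -mulmxA PQ mulmx1.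
Qed.

Section TraceIdentities.
Variables (R : realType) (n : nat).
Implicit Types (A B X S H : 'M[R[i]]_n).

Lemma comm_ofBr A B X : comm_of X (A - B) = comm_of X A - comm_of X B.
Proof.
rewrite /comm_of mulmxBl mulmxBr !opprB addrACA [RHS]addrACA; congr (_ + _).
exact: addrC.
Qed.

Lemma comm_ofDl A B X : comm_of (A + B) X = comm_of A X + comm_of B X.
Proof. by rewrite /comm_of mulmxDl mulmxDr opprD addrACA. Qed.

Lemma comm_ofZl c A X : comm_of (c *: A) X = c *: comm_of A X.
Proof. by rewrite /comm_of -scalemxAl -scalemxAr scalerBr. Qed.

Lemma tr_mul_comm A B : \tr (A *m comm_of B A) = 0.
Proof.
by rewrite /comm_of mulmxBr raddfB /= mulmxA mxtrace_mulC mulmxA subrr.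
Qed.

Lemma feedbackE H X S : feedback H X S = - 'i * \tr (comm_of H X *m S).
Proof. by rewrite /feedback comm_ofZl -scalemxAl mxtraceZ. Qed.

(** By cyclicity of the trace, the feedback sees [X] and [S] only through their commutator. *)
Lemma feedback_comm H X S : feedback H X S = - 'i * \tr (H *m comm_of X S).
Proof.
rewrite feedbackE /comm_of mulmxBl mulmxBr !raddfB /= !mulmxA.
by congr (_ * (_ - _)); rewrite -[LHS]mxtrace_mulC mulmxA mxtrace_mulC mulmxA.
Qed.

Lemma feedbackB H X X' S : feedback H (X - X') S = feedback H X S - feedback H X' S.
Proof. by rewrite !feedbackE comm_ofBr mulmxBl raddfB mulrBr. Qed.

(** With h the common diagonal entry of [H], the trace of H diag(c) is h times the sum of the c_k,
    which is Tr [X, S] = 0. *)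
Lemma feedback_comm_diag H X S c : constant_diagonal H ->
  comm_of X S = diag_mx c -> feedback H X S = 0.
Proof.
move=> Hd XS; rewrite feedback_comm XS mul_mx_diag.
have : \tr (comm_of X S) = 0 by rewrite /comm_of raddfB /= mxtrace_mulC subrr.
rewrite XS mxtrace_diag => c0; apply/eqP; rewrite mulf_eq0; apply/orP; right.
rewrite /mxtrace; under eq_bigr do rewrite mxE.
(* The common diagonal value is named through an index [k]; for [n = 0] the sum is empty. *)
case: (pickP (@predT 'I_n)) => [k _|n0]; last by rewrite big1 // => k; have := n0 k.
by under eq_bigr do rewrite (Hd _ k); rewrite -mulr_sumr c0 mulr0.
Qed.

(** The drift gives Tr((X - S)[H0, X - S]) = 0, and since Tr(X [H1, X]) = 0 the control term keeps
    only its pairing with [S]. The scalar [f] is arbitrary because [S] will be either the target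
    state or the free evolution of [rho1]. *)
Lemma tr_sqr_deriv H0 H1 (f : R[i]) X S :
  \tr ((X - S) *m (- 'i *: comm_of (H0 + f *: H1) X - (- 'i *: comm_of H0 S)))
  = - f * feedback H1 X S.
Proof.
rewrite comm_ofDl comm_ofZl -scalerBr addrAC -comm_ofBr -scalemxAr mxtraceZ.
rewrite mulmxDr -scalemxAr raddfD /= tr_mul_comm add0r mxtraceZ.
rewrite mulmxBl raddfB /= tr_mul_comm add0r feedbackE mxtrace_mulC.
by rewrite !(mulrN, mulNr) !opprK mulrCA.
Qed.

Lemma is_cderive_trsqr H0 H1 f (X S : R -> 'M[R[i]]_n) t :
  is_mxderive X t (- 'i *: comm_of (H0 + f *: H1) (X t)) ->
  is_mxderive S t (- 'i *: comm_of H0 (S t)) ->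
  is_cderive (fun s => \tr ((X s - S s) *m (X s - S s))) t
    (- 2 * f * feedback H1 (X t) (S t)).
Proof.
move=> HX HS; have HD := is_mxderiveB HX HS.
have := is_cderive_trmul HD HD.
rewrite [X in X + _]mxtrace_mulC tr_sqr_deriv.
by congr is_cderive; rewrite /=; ring.
Qed.

Lemma is_cderive_lyapunov H0 H1 (X S : R -> 'M[R[i]]_n) t :
  is_mxderive X t (- 'i *: comm_of (H0 + feedback H1 (X t) (S t) *: H1) (X t)) ->
  is_mxderive S t (- 'i *: comm_of H0 (S t)) ->
  is_cderive (fun s => lyapunov (X s) (S s)) t (- feedback H1 (X t) (S t) ^+ 2).
Proof.
move=> HX HS; have := is_cderiveZ (2^-1) (is_cderive_trsqr HX HS).
congr is_cderive.
by field.
Qed.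

End TraceIdentities.

(** * Bounds by the entrywise and Frobenius norms *)

Section EntrywiseNorm.
Variables (R : realType) (n : nat).
Implicit Types (A B X S H : 'M[R[i]]_n).

(** This norm is submultiplicative, bounds the trace, and is unchanged when entries are multiplied
    by phases. *)
Definition mxnorm1 A : R[i] := \sum_k \sum_l `|A k l|.

Lemma mxnorm1_ge0 A : 0 <= mxnorm1 A.
Proof. by do 2![apply: sumr_ge0 => ? _]. Qed.

Lemma mxnorm1B A B : mxnorm1 (A - B) <= mxnorm1 A + mxnorm1 B.
Proof.
rewrite /mxnorm1 -big_split; apply: ler_sum => k _ /=.
rewrite -big_split; apply: ler_sum => l _ /=.
by rewrite !mxE ler_normB.
Qed.

Lemma mxnorm1M A B : mxnorm1 (A *m B) <= mxnorm1 A * mxnorm1 B.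
Proof.
rewrite {1 2}/mxnorm1 mulr_suml; apply: ler_sum => k _.
apply: (@le_trans _ _ (\sum_l \sum_j `|A k j| * `|B j l|)).
  apply: ler_sum => l _; rewrite mxE; apply: le_trans (ler_norm_sum _ _ _) _.
  by apply: ler_sum => j _; rewrite normrM.
rewrite exchange_big mulr_suml; apply: ler_sum => j _ /=.
rewrite -mulr_sumr ler_wpM2l // /mxnorm1 [leRHS](bigD1 j) //= lerDl.
by do 2![apply: sumr_ge0 => ? _].
Qed.

Lemma tr_le_mxnorm1 A : `|\tr A| <= mxnorm1 A.
Proof.
apply: le_trans (ler_norm_sum _ _ _) _; apply: ler_sum => k _.
by rewrite [leRHS](bigD1 k) //= lerDl sumr_ge0.
Qed.

(** The two terms of the commutator give the factor 2. The bound is linear in [X], which will be a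
    difference of two trajectories. *)
Lemma feedback_le H X S :
  `|feedback H X S| <= 2 * mxnorm1 H * mxnorm1 S * mxnorm1 X.
Proof.
rewrite feedbackE normrM normrN normCi mul1r.
apply: le_trans (tr_le_mxnorm1 _) _; apply: le_trans (mxnorm1M _ _) _.
rewrite mulrAC ler_wpM2r ?mxnorm1_ge0 //.
apply: le_trans (mxnorm1B _ _) _.
rewrite -mulrA mulr_natl mulr2n lerD //; first exact: mxnorm1M.
by rewrite mulrC; exact: mxnorm1M.
Qed.

(** As X_lk is the conjugate of X_kl, the trace of the square is the squared Frobenius norm. *)
Lemma tr_sqr_herm X : X \is hermsymmx ->
  \tr (X *m X) = \sum_k \sum_l `|X k l| ^+ 2.
Proof.
move=> /is_hermitianmxP; rewrite expr0 scale1r => XE.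
apply: eq_bigr => k _; rewrite mxE; apply: eq_bigr => l _.
by rewrite normCK {2}XE !mxE.
Qed.

Lemma tr_sqr_ge0 X : X \is hermsymmx -> 0 <= \tr (X *m X).
Proof.
by move=> /tr_sqr_herm ->; do 2![apply: sumr_ge0 => ? _]; exact: exprn_ge0.
Qed.

Lemma entry_le_tr_sqr X k l : X \is hermsymmx -> `|X k l| <= sqrtC (\tr (X *m X)).
Proof.
move=> XH; rewrite -(@ler_pXn2r _ 2) ?nnegrE ?sqrtC_ge0 ?tr_sqr_ge0 //.
rewrite sqrtCK tr_sqr_herm // (bigD1 k) //= (bigD1 l) //= -addrA lerDl addr_ge0 //.
  by apply: sumr_ge0 => ? _; exact: exprn_ge0.
by do 2![apply: sumr_ge0 => ? _]; exact: exprn_ge0.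
Qed.

Lemma tr_sqr_eq0 X : X \is hermsymmx -> \tr (X *m X) = 0 -> X = 0.
Proof.
move=> XH X0; apply/matrixP => k l; rewrite mxE; apply/eqP.
by rewrite -normr_le0; have := entry_le_tr_sqr k l XH; rewrite X0 sqrtC0.
Qed.

(** Each of the n^2 entries is at most the Frobenius norm. *)
Lemma mxnorm1_le_tr_sqr X : X \is hermsymmx ->
  mxnorm1 X <= (n * n)%:R * sqrtC (\tr (X *m X)).
Proof.
move=> XH; apply: (@le_trans _ _ (\sum_(k < n) \sum_(l < n) sqrtC (\tr (X *m X)))).
  by do 2![apply: ler_sum => ? _]; exact: entry_le_tr_sqr.
by rewrite !sumr_const card_ord -mulrnA mulr_natl.
Qed.

End EntrywiseNorm.

(** * Free evolution and closed-loop solutions *)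

Section FreeEvolution.
Variables (R : realType) (n : nat) (a : 'I_n -> R).
Implicit Types (A B : 'M[R[i]]_n) (t : R).
Let H0 : 'M[R[i]]_n := diag_mx (\row_k (a k)%:C).

(* The entries of exp(-i H0 t) A exp(i H0 t). *)
Definition evolve A t : 'M[R[i]]_n :=
  \matrix_(k, l) (phase ((a l - a k) * t) * A k l).

Lemma evolve0 A : evolve A 0 = A.
Proof. by apply/matrixP => k l; rewrite mxE mulr0 phase0 mul1r. Qed.

Lemma evolveM A B t : evolve (A *m B) t = evolve A t *m evolve B t.
Proof.
apply/matrixP => k l; rewrite !mxE mulr_sumr; apply: eq_bigr => j _.
(* Frequencies add along the path [k], [j], [l]: (a_j - a_k) + (a_l - a_j) = a_l - a_k. *)
rewrite !mxE mulrACA -phaseD -mulrDl; congr (phase (_ * _) * _).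
ring.
Qed.

Lemma evolveB A B t : evolve (A - B) t = evolve A t - evolve B t.
Proof. by apply/matrixP => k l; rewrite !mxE mulrBr. Qed.

Lemma evolve_comm A B t :
  evolve (comm_of A B) t = comm_of (evolve A t) (evolve B t).
Proof. by rewrite /comm_of evolveB !evolveM. Qed.

Lemma evolve_diag (c : 'rV[R[i]]_n) t : evolve (diag_mx c) t = diag_mx c.
Proof.
apply/matrixP => k l; rewrite !mxE; case: eqVneq => [->|]; last by rewrite mulr0.
by rewrite subrr mul0r phase0 mul1r.
Qed.

Lemma mxnorm1_evolve A t : mxnorm1 (evolve A t) = mxnorm1 A.
Proof.
by do 2![apply: eq_bigr => ? _]; rewrite mxE normrM norm_phase mul1r.
Qed.

Lemma comm_ofH0E A k l : comm_of H0 A k l = (a k - a l)%:C * A k l.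
Proof.
by rewrite /comm_of mul_diag_mx mul_mx_diag !mxE rmorphB /= mulrBl [A k l * _]mulrC.
Qed.

Lemma is_mxderive_evolve A t :
  is_mxderive (evolve A) t (- 'i *: comm_of H0 (evolve A t)).
Proof.
move=> k l; rewrite mxE comm_ofH0E mxE; under eq_fun do rewrite mxE.
have := is_cderiveM (is_cderive_phase (a l - a k) t) (is_cderive_cst (A k l) t).
by congr is_cderive; rewrite complexiE !rmorphB /=; ring.
Qed.

(** As [H0] is diagonal, the equation decouples into one scalar linear equation per entry. *)
Lemma evolve_unique (X : R -> 'M[R[i]]_n) :
  (forall t, is_mxderive X t (- 'i *: comm_of H0 (X t))) ->
  forall t, X t = evolve (X 0) t.
Proof.
move=> HX t; apply/matrixP => k l; rewrite mxE.
apply: (@phase_ode _ (fun s => X s k l)) => s.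
have := HX s k l; rewrite mxE comm_ofH0E.
by congr is_cderive; rewrite complexiE !rmorphB /=; ring.
Qed.

(** The propagator exp(-i H0 t). *)
Let U t : 'M[R[i]]_n := diag_mx (\row_k phase (- (a k * t))).

Let U_unitary t : U t *m (U t)^t* = 1%:M.
Proof.
apply/matrixP => k l; rewrite mul_diag_mx !mxE eq_sym; case: eqVneq => [->|_].
  by rewrite mulr1n conj_phase phase_mulN.
by rewrite mulr0n rmorph0 mulr0.
Qed.

(** Unitary conjugation makes the invariance of trace, spectrum and positivity visible, while the
    entrywise form serves for derivatives. *)
Lemma evolveE A t : evolve A t = U t *m A *m (U t)^t*.
Proof.
have -> : (U t)^t* = diag_mx (\row_k phase (a k * t)).
  apply/matrixP => k l; rewrite !mxE eq_sym; case: eqVneq => [->|_].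
    by rewrite !mulr1n conj_phase opprK.
  by rewrite !mulr0n rmorph0.
apply/matrixP => k l; rewrite mul_mx_diag mul_diag_mx !mxE mulrAC -phaseD.
by congr (phase _ * _); ring.
Qed.

Lemma isospectral_evolve (rho0 A : 'M[R[i]]_n) t :
  isospectral rho0 A -> isospectral rho0 (evolve A t).
Proof.
move=> [[[/is_hermitianmxP Ah Apos] Atr] Asp]; split; last first.
  by move=> z; rewrite -Asp evolveE char_poly_conj.
split; last first.
  by rewrite -Atr evolveE mxtrace_mulC mulmxA (mulmx1C (U_unitary t)) mul1mx.
split.
  apply/is_hermitianmxP; move: Ah; rewrite !expr0 !scale1r => Ah.
  apply/matrixP => k l; rewrite !mxE rmorphM /= conj_phase -mulNr opprB.
  by rewrite {1}Ah !mxE.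
(* The quadratic form of the evolved matrix at [v] is that of [A] at the vector U* v. *)
move=> v; have := Apos ((U t)^t* *m v).
have -> : ((U t)^t* *m v)^t* = v^t* *m U t.
  rewrite trmx_mul map_mxM; congr (_ *m _).
  by apply/matrixP => k l; rewrite !mxE; exact: conjCK.
by rewrite evolveE !mulmxA.
Qed.

(** * Closed-loop solutions and their comparison with the free evolution *)

Section Solutions.
Variables (H1 rho0 rho1 rho2 : 'M[R[i]]_n).
Variables (rho rhod : R -> 'M[R[i]]_n).
Hypothesis sol : is_solution H0 H1 rho0 rho1 rho2 rho rhod.

Lemma solution_rhod t : rhod t = evolve rho2 t.
Proof. by have [[_ <-] _ _ /evolve_unique] := sol. Qed.

Lemma solution_lyapunov t :
  is_cderive (fun s => lyapunov (rho s) (rhod s)) t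
    (- feedback H1 (rho t) (rhod t) ^+ 2).
Proof. by have [_ _ Hr Hd] := sol; apply: is_cderive_lyapunov. Qed.

Lemma solution_free :
  (forall t, feedback H1 (rho t) (rhod t) = 0) -> forall t, rho t = evolve rho1 t.
Proof.
have [[<- _] _ Hr _] := sol => f0; apply: evolve_unique => t.
by have := Hr t; rewrite f0 scale0r addr0.
Qed.

(* The difference D of [rho] and the free evolution of [rho1] satisfies
   d/dt Tr D^2 = - 2 feedback(D, rhod) feedback(D, evolve rho1), which is
   quadratic in D. *)
Lemma solution_diag_comm (c : 'rV[R[i]]_n) : constant_diagonal H1 ->
  comm_of rho1 rho2 = diag_mx c ->
  forall t, rho t = evolve rho1 t.
Proof.
move=> Hdiag Hc.
have [[rho_0 _] iso Hr _] := sol.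
pose r := evolve rho1; pose D t := rho t - r t.
have iso1 : isospectral rho0 rho1 by rewrite -rho_0; case: (iso 0).
have Dh t : D t \is hermsymmx.
  have [[[/is_hermitianmxP + _] _] _] := (iso t).1.
  have [[[/is_hermitianmxP + _] _] _] := isospectral_evolve t iso1.
  rewrite expr0 !scale1r => rE rhoE; apply/is_hermitianmxP.
  rewrite expr0 scale1r /D /r {1}rE {1}rhoE.
  by apply/matrixP => k l; rewrite !mxE rmorphB.
(* The commutator of [r t] and [rhod t] is the evolved diag(c), that is diag(c) itself, so [r]
   contributes nothing to the feedback against [rhod]. *)
have fD t : feedback H1 (D t) (rhod t) = feedback H1 (rho t) (rhod t).
  rewrite feedbackB (feedback_comm_diag (X := r t) (c := c)) ?subr0 //.
  by rewrite solution_rhod /r -evolve_comm Hc evolve_diag.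
(* Since [r, r] = 0, [r] contributes nothing here either; hence both factors of [dq] are linear in
   [D]. *)
have fD1 t : feedback H1 (D t) (r t) = feedback H1 (rho t) (r t).
  rewrite feedbackB (feedback_comm_diag (X := r t) (c := 0)) ?subr0 //.
  by rewrite /comm_of subrr; apply/matrixP => k l; rewrite !mxE mul0rn.
pose q t := \tr (D t *m D t).
pose dq t := - 2 * feedback H1 (D t) (rhod t) * feedback H1 (D t) (r t).
have q_ge0 t : 0 <= q t by exact: tr_sqr_ge0.
have qE t : q t = (complex.Re (q t))%:C by rewrite RRe_real // ger0_real.
have Hq t : is_cderive q t (dq t).
  rewrite /dq fD fD1; apply: is_cderive_trsqr; first exact: Hr.
  exact: is_mxderive_evolve.
(* [L A] will bound the feedback of [D t] against the evolved [A], relative to the square root of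
   [q t]; it is uniform in time because [evolve] preserves [mxnorm1]. *)
pose L (S : 'M[R[i]]_n) : R[i] := 2 * mxnorm1 H1 * mxnorm1 S * (n * n)%:R.
pose K : R[i] := 2 * (L rho2 * L rho1).
have K_ge0 : 0 <= K by rewrite !mulr_ge0 ?mxnorm1_ge0.
have fle t A : `|feedback H1 (D t) (evolve A t)| <= L A * sqrtC (q t).
  apply: le_trans (feedback_le _ _ _) _; rewrite mxnorm1_evolve -[leRHS]mulrA.
  by rewrite ler_wpM2l ?mulr_ge0 ?mxnorm1_ge0 // mxnorm1_le_tr_sqr.
(* Two factors of order sqrt(q) give the bound linear in [q] that Gronwall requires. *)
have bdq t : `|dq t| <= K * q t.
  rewrite /dq -mulrA normrM normrN normr_nat normrM solution_rhod.
  rewrite -[q t]sqrtCK expr2 -mulrA [L _ * _ * _]mulrACA.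
  by rewrite ler_wpM2l // ler_pM //; exact: fle.
(* Gronwall is a statement over the reals, so it is applied to real parts; [q] and [K] are real. *)
have Re_q0 : forall t, complex.Re (q t) = 0.
  apply: (@gronwall_zero _ _ (fun t => complex.Re (dq t)) (complex.Re K)).
  - by move=> t; have [] := Hq t.
  - move=> t; have := le_trans (normc_ge_Re (dq t)) (bdq t).
    by rewrite qE -(RRe_real (ger0_real K_ge0)) -rmorphM /= lecR.
  - by move=> t; rewrite -ler0c -qE.
  - by rewrite /q /D /r rho_0 evolve0 subrr mul0mx raddf0.
move=> t; apply/eqP; rewrite -subr_eq0; apply/eqP.
by apply: tr_sqr_eq0 (Dh t) _; rewrite -/(q t) qE Re_q0.
Qed.

End Solutions.

(** * Frequencies of the feedback along free evolutions *)

(** A zero frequency would equal its opposite, the frequency of the transposed pair, against strong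
    regularity. *)
Lemma strongly_regular_neq0 : strongly_regular a ->
  forall k l, k != l -> a l - a k != 0.
Proof.
move=> Ha k l kl; apply/eqP => w0.
have lk : l != k by rewrite eq_sym.
have E : a l - a k = a k - a l by rewrite -[RHS]opprB w0 oppr0.
by have [kl' _] := Ha _ _ _ _ kl lk E; rewrite kl' eqxx in kl.
Qed.

Lemma free_feedback_diag H1 A B : ideal a H1 ->
  (forall t, feedback H1 (evolve A t) (evolve B t) = 0) ->
  exists c : 'rV[R[i]]_n, comm_of A B = diag_mx c.
Proof.
move=> [Hreg Hfull] f0; pose C := comm_of A B.
have fE t : \sum_k H1 k k * C k k + \sum_(p : 'I_n * 'I_n | p.1 != p.2)
    H1 p.2 p.1 * C p.1 p.2 * phase ((a p.2 - a p.1) * t) = 0.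
  have := f0 t; rewrite feedback_comm -evolve_comm => /eqP.
  rewrite mulf_eq0 oppr_eq0 (negPf (neq0Ci _)) /= => /eqP tr0.
  apply: etrans tr0.
  have <- : \sum_k \sum_(l | k != l) H1 l k * C k l * phase ((a l - a k) * t)
      = \sum_(p : 'I_n * 'I_n | p.1 != p.2)
          H1 p.2 p.1 * C p.1 p.2 * phase ((a p.2 - a p.1) * t).
    exact: pair_big_dep.
  rewrite mxtrace_mulC -big_split.
  apply: eq_bigr => k _; rewrite [RHS]mxE [RHS](bigD1 k) //= [evolve _ _ k k]mxE.
  rewrite subrr mul0r phase0 mul1r mulrC.
  congr (_ + _); apply: eq_big => [l|l _]; first by rewrite eq_sym.
  by rewrite [evolve _ _ k l]mxE; ring.
pose offdiag := enum [pred p : 'I_n * 'I_n | p.1 != p.2].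
(* [None] carries the frequency 0, which collects all diagonal terms; [Some p] stands for the
   off-diagonal position [p]. *)
pose w (o : option ('I_n * 'I_n)) := if o is Some p then a p.2 - a p.1 else 0.
pose d (o : option ('I_n * 'I_n)) :=
  if o is Some p then H1 p.2 p.1 * C p.1 p.2 else \sum_k H1 k k * C k k.
(* No off-diagonal frequency is 0, and strong regularity separates them from one another. *)
have w_uniq : uniq [seq w o | o <- None :: [seq Some p | p <- offdiag]].
  rewrite /= -map_comp; apply/andP; split.
    apply/mapP => -[p]; rewrite mem_enum inE => pd /esym /eqP.
    by apply/negP; exact: strongly_regular_neq0.
  rewrite map_inj_in_uniq ?enum_uniq // => -[k l] [k' l'].
  by rewrite !mem_enum !inE => kl kl' /Hreg; exact.
have d0 t : \sum_(o <- None :: [seq Some p | p <- offdiag])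
    d o * phase (w o * t) = 0.
  rewrite -[RHS](fE t) big_cons big_map big_enum /= mul0r phase0 mulr1.
  by congr (_ + _).
have C0 k l : k != l -> C k l = 0.
  move=> kl; have mem_kl : Some (k, l) \in None :: [seq Some p | p <- offdiag].
    by rewrite inE /= mem_map ?mem_enum // => ? ? [].
  have /eqP := phase_free w_uniq d0 mem_kl.
  have lk : l != k by rewrite eq_sym.
  (* Full connectivity cancels the factor [H1 l k]. *)
  by rewrite mulf_eq0 (negPf (Hfull _ _ lk)) => /eqP.
exists (\row_k C k k); apply/matrixP => k l; rewrite [RHS]mxE [in RHS]mxE.
by case: eqVneq => [->|/C0 //]; rewrite mulr1n.
Qed.

End FreeEvolution.

Theorem mainTheorem3 (R : realType) (n : nat) (a : 'I_n -> R)
    (H0 H1 rho0 : 'M[R[i]]_n)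
    (Hrho0 : density rho0)
    (Ha : forall k l : 'I_n, (k <= l)%N -> a l <= a k)
    (HH0 : H0 = diag_mx (\row_k (a k)%:C))
    (HH1 : H1 \is hermsymmx)
    (Hideal : ideal a H1)
    (Hdiag : constant_diagonal H1)
    (rho1 rho2 : 'M[R[i]]_n)
    (Hrho1 : isospectral rho0 rho1) (Hrho2 : isospectral rho0 rho2) :
  invariant_set H0 H1 rho0 rho1 rho2 <->
  exists c : 'rV[R[i]]_n, comm_of rho1 rho2 = diag_mx c.
Proof.
rewrite HH0; split=> [[_ _ [rho [rhod sol]] stat]|[c Hc]].
  (* The derivative of V along the solution is both -f^2 and 0. *)
  have f0 t : feedback H1 (rho t) (rhod t) = 0.
    have /eqP := is_cderive_unique (solution_lyapunov sol t) (stat _ _ sol t).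
    by rewrite oppr_eq0 sqrf_eq0 => /eqP.
  apply: free_feedback_diag Hideal _ => t.
  by rewrite -(solution_free sol f0) -(solution_rhod sol).
(* The free evolution fixes diagonal matrices, so the commutator stays diag(c). With zero feedback
   the free pair solves the closed-loop system. *)
have f0 t : feedback H1 (evolve a rho1 t) (evolve a rho2 t) = 0.
  by apply: (feedback_comm_diag (c := c)) => //; rewrite -evolve_comm Hc evolve_diag.
split=> //.
  exists (evolve a rho1), (evolve a rho2); split.
  - by rewrite !evolve0.
  - by move=> t; split; exact: isospectral_evolve.
  - by move=> t; rewrite f0 scale0r addr0; exact: is_mxderive_evolve.
  - exact: is_mxderive_evolve.
(* By uniqueness an arbitrary solution is the free pair, along which -f^2 = 0. *)
move=> rho rhod sol t; have := solution_lyapunov sol t.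
rewrite (solution_diag_comm sol Hdiag Hc) (solution_rhod sol) f0.
by rewrite expr0n oppr0.
Qed.
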